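(* Let $0<\epsilon<10^{-3}$ and let $k\geq 2$ be an integer. Let $(X,Y,Z,A,\phi)$ be a partial Latin square with $|X|=|Y|=|Z|=n$ containing at least $\epsilon n^5$ octahedra. Then there is a subset $B\subset A$ with $|B|=\beta n^2$, $\beta\geq \epsilon^{10}$, such that for each $2\leq r\leq k$ the $2r$-cycle completion operation in $B$ is $\epsilon^{-33k^3}$-well-defined.
   Context: A partial Latin square is $(X,Y,Z,A,\phi)$ with $A\subset X\times Y$ and $\phi:A\to Z$ injective in each variable separately; cells $(x,y)\in A$ lie in column $x$, row $y$ and carry label $\phi(x,y)$. An octahedron is a tuple $(x_1,x_2,y_1,y_2,x_3,x_4,y_3,y_4)$ with the cells $(x_i,y_j)$ for $i,j\in\{1,2\}$ and for $i,j\in\{3,4\}$ in $A$ and $\phi(x_1,y_1)=\phi(x_3,y_3)$, $\phi(x_2,y_1)=\phi(x_4,y_3)$, $\phi(x_1,y_2)=\phi(x_3,y_4)$, $\phi(x_2,y_2)=\phi(x_4,y_4)$ (degeneracies allowed). A (label) $2r$-cycle in $B$ is a sequence of cells $p_1,\dots,p_{2r}\in B$ such that $p_i$ and $p_{i+1}$ lie in the same row when $i$ is odd and in the same column when $i$ is even (with $p_{2r}$ and $p_1$ in the same column); its label sequence is $(\phi(p_1),\dots,\phi(p_{2r}))$. The $2r$-cycle completion operation in $B$ sends $(z_1,\dots,z_{2r-1})$ to $z_{2r}$ whenever $(z_1,\dots,z_{2r})$ is the label sequence of some $2r$-cycle in $B$; it is $C$-well-defined if for every $(z_1,\dots,z_{2r-1})$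 the number of such $z_{2r}$ is at most $C$. *)

(* Defs.v *)
From HB Require Import structures.
From mathcomp Require Import all_boot all_order all_algebra.
From mathcomp Require Import reals.
Set Implicit Arguments.
Unset Strict Implicit.
Unset Printing Implicit Defensive.
Import Order.TTheory GRing.Theory Num.Theory.
Local Open Scope ring_scope.

(* A labelling A -> Z is given by a total function phi : X * Y -> Z whose
   values outside A are never used. Every labelling of A extends to such a
   phi when #|X| = #|Y| = #|Z|: if Z is empty then so is X * Y. *)
Definition partial_latin_square (X Y Z : finType) (A : {set X * Y})
    (phi : X * Y -> Z) : Prop :=
  (forall x x' y, (x, y) \in A -> (x', y) \in A ->
     phi (x, y) = phi (x', y) -> x = x') /\
  (forall x y y', (x, y) \in A -> (x, y') \in A ->
     phi (x, y) = phi (x, y') -> y = y').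

(* The tuple is (x1, x2, y1, y2, x3, x4, y3, y4). *)
Definition octahedra (X Y Z : finType) (A : {set X * Y}) (phi : X * Y -> Z) :
    {set X * X * Y * Y * X * X * Y * Y} :=
  [set t | let: (x1, x2, y1, y2, x3, x4, y3, y4) := t in
    [&& (x1, y1) \in A, (x1, y2) \in A, (x2, y1) \in A, (x2, y2) \in A,
        (x3, y3) \in A, (x3, y4) \in A, (x4, y3) \in A, (x4, y4) \in A,
        phi (x1, y1) == phi (x3, y3), phi (x2, y1) == phi (x4, y3),
        phi (x1, y2) == phi (x3, y4) & phi (x2, y2) == phi (x4, y4)]].

(* Cells are numbered from 0, so that the cell called p_i on paper has index
   i - 1: even indices share their row (second coordinate) with the next cell,
   odd indices their column (first coordinate). ordS is the cyclic successor,
   so index 2r - 1 is followed by index 0. *)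
Definition is_cycle (X Y : finType) (B : {set X * Y}) (r : nat)
    (p : (2 * r).-tuple (X * Y)) : bool :=
  [forall i : 'I_(2 * r),
    (tnth p i \in B) &&
    (if odd i then (tnth p i).1 == (tnth p (ordS i)).1
     else (tnth p i).2 == (tnth p (ordS i)).2)].

Definition cycle_completions (X Y Z : finType) (phi : X * Y -> Z)
    (B : {set X * Y}) (r : nat) (z : (2 * r).-1.-tuple Z) : {set Z} :=
  [set w | [exists p : (2 * r).-tuple (X * Y),
              is_cycle B p && (map phi p == rcons z w)]].

Definition completion_well_defined (R : realType) (X Y Z : finType)
    (phi : X * Y -> Z) (B : {set X * Y}) (r : nat) (C : R) : Prop :=
  forall z : (2 * r).-1.-tuple Z, #|cycle_completions phi B z|%:R <= C.

(* Main.v *)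
Require Import Defs.
From mathcomp Require Import all_boot all_order all_algebra.
From mathcomp Require Import reals.
From mathcomp Require Import zify ring lra.
Set Implicit Arguments.
Unset Strict Implicit.
Unset Printing Implicit Defensive.
Import Order.TTheory GRing.Theory Num.Theory.
Local Open Scope ring_scope.

(** View the square as a properly edge-coloured bipartite graph on [X + Y], the
    label of a cell being the colour of an edge. Call a rectangle popular if its
    label sequence is shared by at least [eps * n / 2] rectangles; three labels of
    a popular rectangle leave at most [2 / eps] choices for the fourth, and the
    octahedra force [eps / 2 * n ^ 4] popular rectangles.

    For a pivot [q = (u, v)] let [B_q] be the set of cells [(x, y)] that span a
    popular rectangle with [q]. If all edges of a closed walk lie in [B_q] for at
    least [p * n ^ 2] pivots (a rich walk), then its last label is determined by
    the others up to [(4 / eps) ^ length / p] choices: guess the label of [q] and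
    of one spoke, and go around the walk one popular rectangle at a time.

    By averaging over [q], some [B := B_q] is dense while almost all hexagons and
    almost all long closed walks in [B] are rich. Delete from [B] the few edges
    [yx] for which the endpoints have small degree, or for which many pairs of
    neighbors [a] of [y] and [b] of [x] have few paths [a c d b] completing a rich
    hexagon [y a c d b x]. A closed walk [v_0 ... v_(m-1)] of remaining edges then
    has at least a constant proportion of [#|V| ^ (3 m)] extensions: spokes
    [v_i s_i] and paths [s_i c_i d_i s_(i+1)] such that every hexagon on an edge
    [v_i v_(i+1)] is rich and so is the inner walk [s_0 c_0 d_0 s_1 ...]. The
    labels of an extension determine it. Going around the walk through the
    hexagons bounds the number of possible labels of all extensions, for given
    labels of [m - 1] edges of the walk, by a constant times [#|V| ^ (3 m)]; hence
    the last label takes boundedly many values. *)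

(** * Counting *)

Lemma subset_leq_cardU (T : finType) (A B C : {set T}) :
  A \subset B :|: C -> (#|A| <= #|B| + #|C|)%N.
Proof. by move=> /subset_leq_card/leq_trans; apply; apply: leq_card_setU. Qed.

Lemma leq_card_bigcup (I T : finType) (P : pred I) (F : I -> {set T}) :
  (#|\bigcup_(i | P i) F i| <= \sum_(i | P i) #|F i|)%N.
Proof.
elim/big_ind2: _ => [|m S m' S' le1 le2|//]; first by rewrite cards0.
by apply: leq_trans (leq_card_setU _ _) (leq_add _ _).
Qed.

Lemma card_bigcup_le (R : numDomainType) (I T : finType) (A : {set I})
    (F : I -> {set T}) (D : R) :
  (forall i, #|F i|%:R <= D) -> #|\bigcup_(i in A) F i|%:R <= #|A|%:R * D.
Proof.
move=> F_le; rewrite mulr_natl -[leRHS]sumr_const.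
apply: (@le_trans _ _ (\sum_(i in A) #|F i|%:R)); last exact: ler_sum.
by rewrite -natr_sum ler_nat leq_card_bigcup.
Qed.

Section CardPairs.
Variables (R : numDomainType) (S T : finType) (P : S -> T -> bool).

Lemma card_pairs : #|[set p : S * T | P p.1 p.2]| = (\sum_a #|[set b | P a b]|)%N.
Proof.
rewrite -sum1_card; under eq_bigl do rewrite inE.
rewrite -(pair_big_dep predT P (fun _ _ => 1%N)) /=.
by apply: eq_bigr => a _; rewrite -sum1_card; apply: eq_bigl => b; rewrite inE.
Qed.

Lemma card_pairsC : #|[set p : S * T | P p.1 p.2]| = (\sum_b #|[set a | P a b]|)%N.
Proof.
have cardE (U : finType) (Q : pred U) : #|[set a | Q a]| = (\sum_(a | Q a) 1)%N.
  by rewrite -sum1_card; apply: eq_bigl => a; rewrite inE.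
rewrite card_pairs; under eq_bigr do rewrite cardE.
by rewrite (exchange_big_dep predT) //=; apply: eq_bigr => b _; rewrite cardE.
Qed.

Lemma card_heavy_fibers (c : R) :
  #|[set a | c <= #|[set b | P a b]|%:R]|%:R * c
    <= #|[set p : S * T | P p.1 p.2]|%:R.
Proof.
rewrite card_pairs natr_sum mulr_natl -sumr_const big_mkcond /=.
by apply: ler_sum => a _; rewrite inE; case: ifP.
Qed.

End CardPairs.

Lemma card_pairs_swap (S T : finType) (P : S -> T -> bool) :
  #|[set p : T * S | P p.2 p.1]| = #|[set p : S * T | P p.1 p.2]|.
Proof. by rewrite card_pairsC (card_pairs (fun b a => P a b)). Qed.

Lemma card_light_fibers (R : numDomainType) (S T : finType) (P : S -> T -> bool)
    (c : R) : 0 <= c ->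
  #|[set p : S * T | P p.1 p.2 && (#|[set a | P a p.2]|%:R < c)]|%:R
    <= #|T|%:R * c.
Proof.
move=> c_ge0; rewrite (card_pairsC (fun a b => P a b && (#|[set a | P a b]|%:R < c))).
rewrite natr_sum mulr_natl -sumr_const; apply: ler_sum => b _.
case: (boolP (_ < c)) => [/ltW light|_].
  apply: le_trans light; rewrite ler_nat subset_leq_card //; apply/subsetP => a.
  by rewrite !inE andbT.
by rewrite (_ : [set _ | _] = set0) ?cards0 //; apply/setP => a; rewrite !inE andbF.
Qed.

(* Double counting of the pairs of an element of [W] and one of its codes. *)
Lemma card_mul_le_codes (R : numDomainType) (S C : finType) (W : {set S})
    (G : {set C}) (decodes : C -> S -> Prop) (c D : R) :
  (forall z, z \in W -> exists A : {set C},
     [/\ A \subset G, c <= #|A|%:R & forall g, g \in A -> decodes g z]) ->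
  (forall g (W' : {set S}), (forall z, z \in W' -> decodes g z) -> #|W'|%:R <= D) ->
  #|W|%:R * c <= #|G|%:R * D.
Proof.
move=> codes few_decoded.
have /fin_all_exists [A AP] : forall z, exists A : {set C}, z \in W ->
    [/\ A \subset G, c <= #|A|%:R & forall g, g \in A -> decodes g z].
  by move=> z; case: (boolP (z \in W)) => [/codes[A ?]|_]; [exists A | exists set0].
pose P z g := (z \in W) && (g \in A z).
apply: (@le_trans _ _ #|[set p | P p.1 p.2]|%:R).
  rewrite card_pairs natr_sum mulr_natl -sumr_const big_mkcond.
  apply: ler_sum => z _; case: ifP => // zW; have [_ /le_trans-> //] := AP z zW.
  by rewrite ler_nat subset_leq_card //; apply/subsetP => g; rewrite inE /P zW.
rewrite card_pairsC natr_sum mulr_natl -sumr_const [leRHS]big_mkcond.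
apply: ler_sum => g _; case: ifP => [_|/negbT gG].
  apply: (few_decoded g) => z; rewrite inE => /andP[/AP[_ _]]; apply.
rewrite (_ : [set _ | _] = set0) ?cards0 //; apply/setP => z; rewrite !inE.
by apply/negP => /andP[/AP[/subsetP AG _ _] /AG]; apply/negP.
Qed.

Section CardFamily.
Variables (aT rT : finType) (F : aT -> {set rT}).

Lemma card_family_prod : #|family F| = (\prod_i #|F i|)%N.
Proof. by rewrite card_family foldrE big_image. Qed.

Lemma card_family_ge (R : numDomainType) (c : R) :
  0 <= c -> (forall i, c <= #|F i|%:R) -> c ^+ #|aT| <= #|family F|%:R.
Proof.
move=> c_ge0 cF; rewrite card_family_prod natr_prod -prodr_const.
by apply: ler_prod => i _; rewrite c_ge0 cF.
Qed.

End CardFamily.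

Lemma card_family_pair (aT rT : finType) (F : aT -> {set rT}) (i j : aT)
    (D : {set rT * rT}) : i != j ->
  (#|[set s in family F | (s i, s j) \in D]| * (#|F i| * #|F j|)
     <= #|D| * #|family F|)%N.
Proof.
move=> ij.
pose fixed p l := if l == i then [set p.1] else if l == j then [set p.2] else F l.
pose rest := (\prod_(l | (l != i) && (l != j)) #|F l|)%N.
have card_fixed p : #|family (fixed p)| = rest.
  rewrite card_family_prod (bigD1 i) //= (bigD1 j) 1?eq_sym //=.
  rewrite {1 2}/fixed eqxx eq_sym (negPf ij) eqxx !cards1 !mul1n.
  by apply: eq_bigr => l /andP[/negPf il /negPf jl]; rewrite /fixed il jl.
have -> : #|family F| = (#|F i| * #|F j| * rest)%N.
  by rewrite card_family_prod (bigD1 i) //= (bigD1 j) 1?eq_sym //= mulnA.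
rewrite mulnC [leqRHS]mulnCA leq_mul2l; apply/orP; right.
apply: (@leq_trans #|\bigcup_(p in D) [set s in family (fixed p)]|).
  apply/subset_leq_card/subsetP => s; rewrite inE => /andP[/familyP sF sD].
  apply/bigcupP; exists (s i, s j) => //; rewrite inE; apply/familyP => l.
  by rewrite /fixed; case: eqP => [->|_]; last case: eqP => [->|_]; rewrite ?inE.
apply: leq_trans (leq_card_bigcup _ _) _; rewrite -sum_nat_const.
by apply: leq_sum => p _; rewrite cardsE card_fixed.
Qed.

Lemma exists_large_with_small_exceptions (R : realFieldType) (Q : finType)
    (c F G1 G2 : R) (f g1 g2 : Q -> R) :
  (0 < #|Q|)%N -> 0 < F -> 0 < G1 -> 0 < G2 ->
  (forall q, f q <= F) -> (forall q, 0 <= g1 q) -> (forall q, 0 <= g2 q) ->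
  0 <= c -> c * F * #|Q|%:R <= \sum_q f q ->
  \sum_q g1 q <= c / 4 * G1 * #|Q|%:R -> \sum_q g2 q <= c / 4 * G2 * #|Q|%:R ->
  exists q, [/\ c / 2 * F <= f q, g1 q <= G1 & g2 q <= G2].
Proof.
move=> Q_gt0 F_gt0 G1_gt0 G2_gt0 fF g1_ge0 g2_ge0 c_ge0 sum_f sum_g1 sum_g2.
pose weight q := f q / F - g1 q / G1 - g2 q / G2.
have : \sum_(q : Q) c / 2 <= \sum_q weight q.
  rewrite !sumrB -!mulr_suml sumr_const -[_ *+ _]mulr_natr.
  move: sum_f sum_g1 sum_g2; rewrite mulrAC -ler_pdivlMr // => sum_f.
  rewrite mulrAC -ler_pdivrMr // => sum_g1; rewrite mulrAC -ler_pdivrMr // => sum_g2.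
  lra.
case: (pickP (fun q => c / 2 <= weight q)) => [q weight_q|no_q] sum_weight; last first.
  have /card_gt0P [q0 _] := Q_gt0; move: sum_weight; rewrite leNgt => /negP[].
  by apply: ltr_sum => [|q _]; [apply/hasP; exists q0; rewrite ?mem_index_enum
                               | rewrite ltNge no_q].
rewrite /weight in weight_q; exists q.
have f_le1 : f q / F <= 1 by rewrite ler_pdivrMr // mul1r.
have g1q : 0 <= g1 q / G1 by rewrite divr_ge0 // ltW.
have g2q : 0 <= g2 q / G2 by rewrite divr_ge0 // ltW.
split; first by rewrite -ler_pdivlMr //; lra.
  by rewrite -[leRHS]mul1r -ler_pdivrMr //; lra.
by rewrite -[leRHS]mul1r -ler_pdivrMr //; lra.
Qed.

Section ClosingLabels.
Variables (R : numDomainType) (S Z : finType) (step : nat -> Z -> rel S) (D : R).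

Definition closes (l : nat -> Z) (n : nat) (s0 : S) (z : Z) : Prop :=
  exists s : nat -> S, [/\ s 0%N = s0,
    forall i, (i < n)%N -> step i (l i) (s i) (s i.+1) & step n z (s n) s0].

Fixpoint reachable (l : nat -> Z) (s0 : S) (n : nat) : {set S} :=
  if n is n'.+1 then \bigcup_(s in reachable l s0 n') [set t | step n' (l n') s t]
  else [set s0].

Lemma mem_reachable (l : nat -> Z) (s : nat -> S) (n : nat) :
  (forall i, (i < n)%N -> step i (l i) (s i) (s i.+1)) ->
  s n \in reachable l (s 0%N) n.
Proof.
elim: n => [|n IHn] steps /=; first by rewrite inE.
apply/bigcupP; exists (s n); last by rewrite inE steps.
by apply: IHn => i /ltnW; apply: steps.
Qed.

Hypothesis card_next : forall i z s, #|[set t | step i z s t]|%:R <= D.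
Hypothesis card_label : forall i s t, #|[set z | step i z s t]|%:R <= D.

Lemma card_reachable (l : nat -> Z) (s0 : S) (n : nat) :
  #|reachable l s0 n|%:R <= D ^+ n.
Proof.
have D_ge0 : 0 <= D by apply: le_trans (card_next 0 (l 0%N) s0).
elim: n => [|n IHn] /=; first by rewrite cards1.
apply: le_trans (card_bigcup_le _ (card_next n (l n))) _.
by rewrite exprSr ler_wpM2r.
Qed.

Lemma card_closing_labels (l : nat -> Z) (n : nat) (s0 : S) (W : {set Z}) :
  (forall z, z \in W -> closes l n s0 z) -> #|W|%:R <= D ^+ n.+1.
Proof.
move=> closesW; have D_ge0 : 0 <= D by apply: le_trans (card_next 0 (l 0%N) s0).
have label_to_s0 s := card_label n s s0.
apply: (@le_trans _ _ #|\bigcup_(s in reachable l s0 n) [set z | step n z s s0]|%:R).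
  rewrite ler_nat subset_leq_card //; apply/subsetP => z.
  case/closesW=> s [<- steps last_step].
  by apply/bigcupP; exists (s n); [apply: mem_reachable | rewrite inE].
apply: le_trans (card_bigcup_le _ label_to_s0) _.
by rewrite exprSr ler_wpM2r // card_reachable.
Qed.

End ClosingLabels.

Section Walks.
Variables (V Z : finType) (lab : V -> V -> Z).
Implicit Types (E : rel V) (w : nat -> V) (l : nat -> Z).

Definition walk E w (n : nat) : bool := all (fun i => E (w i) (w i.+1)) (iota 0 n).

Lemma walkP E w n :
  reflect (forall i, (i < n)%N -> E (w i) (w i.+1)) (walk E w n).
Proof.
apply: (iffP allP) => Ew i; last by rewrite mem_iota => /andP[_]; apply: Ew.
by move=> i_n; apply: Ew; rewrite mem_iota.
Qed.

Lemma walk_sub E E' w n : subrel E E' -> walk E w n -> walk E' w n.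
Proof. by move=> EE' /walkP Ew; apply/walkP => i /Ew/EE'. Qed.

Definition completes l (n : nat) (z : Z) w : Prop :=
  [/\ w n.+1 = w 0%N, forall i, (i < n)%N -> lab (w i) (w i.+1) = l i
    & lab (w n) (w n.+1) = z].

Definition completions_le (R : numDomainType) E (n : nat) (C : R) : Prop :=
  forall l (W : {set Z}),
    (forall z, z \in W -> exists2 w, walk E w n.+1 & completes l n z w) ->
  #|W|%:R <= C.

Lemma completions_le_sub (R : numDomainType) E E' n (C : R) :
  subrel E E' -> completions_le E' n C -> completions_le E n C.
Proof.
move=> EE' leC l W completions; apply: (leC l) => z /completions[w Ew wP].
by exists w => //; apply: walk_sub EE' Ew.
Qed.

(* Going back and forth along the first edge lengthens a closed walk by 2. *)
Lemma completions_le_pad (R : numDomainType) E n (C : R) j :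
  symmetric E -> (forall u v, lab u v = lab v u) -> (0 < n)%N ->
  completions_le E (n + 2 * j) C -> completions_le E n C.
Proof.
move=> E_sym lab_sym n_gt0; elim: j => [|j IHj]; first by rewrite addn0.
rewrite mulnS addnCA => leC; apply: IHj => l W completions.
have m_gt0 : (0 < n + 2 * j)%N by rewrite addn_gt0 n_gt0.
apply: (leC (fun i => if i is i'.+2 then l i' else l 0%N)) => z.
case/completions=> w /walkP Ew [w_closed lab_w <-].
exists (fun i => if i is i'.+2 then w i' else w i).
  apply/walkP => -[|[|i]] //=; first by move=> _; apply: Ew.
    by move=> _; rewrite E_sym; apply: Ew.
  exact: Ew.
split=> // -[|[|i]] /=; first by move=> _; apply: lab_w.
  by move=> _; rewrite lab_sym; apply: lab_w.
exact: lab_w.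
Qed.

End Walks.

(** * Deleting poor edges and extending closed walks *)

Section Configurations.
Variables (V : finType) (M : nat).
Local Notation m := M.+1.
Local Notation L := (3 * M).+2.

(* [(s, f)] with [f i = (c_i, d_i)] encodes the closed walk of length
   [3 * m = L.+1] on the vertices s_0 c_0 d_0 s_1 c_1 d_1 ..., indices being
   taken modulo [m]. *)
Definition config := ({ffun 'I_m -> V} * {ffun 'I_m -> V * V})%type.

Definition inner (t : config) (j : nat) : V :=
  let i := inZp (j %/ 3) in
  match (j %% 3)%N with 0%N => t.1 i | 1%N => (t.2 i).1 | _ => (t.2 i).2 end.

Lemma card_config : #|{: config}| = (#|V| ^ L.+1)%N.
Proof.
rewrite card_prod !card_ffun card_prod card_ord -expnMn.
rewrite (_ : (#|V| * (#|V| * #|V|) = #|V| ^ 3)%N) // -expnM.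
by congr (_ ^ _)%N; lia.
Qed.

Lemma inner0 t (i : 'I_m) : inner t (3 * i) = t.1 i.
Proof. by rewrite /inner modnMr mulKn // valZpK. Qed.

Lemma inner1 t (i : 'I_m) : inner t (3 * i).+1 = (t.2 i).1.
Proof. by rewrite /inner -addn1 mulnC modnMDl divnMDl // addn0 valZpK. Qed.

Lemma inner2 t (i : 'I_m) : inner t (3 * i).+2 = (t.2 i).2.
Proof. by rewrite /inner -addn2 mulnC modnMDl divnMDl // addn0 valZpK. Qed.

Lemma inner3 t (i : 'I_m) : inner t (3 * i).+3 = t.1 (ordS i).
Proof.
rewrite -addn3 -mulnSr /inner modnMr mulKn //.
by congr (t.1 _); apply: val_inj.
Qed.

Lemma inner_closed t : inner t L.+1 = inner t 0.
Proof.
rewrite (inner3 t (@ord_max M)) -[0%N in RHS](muln0 3) (inner0 t ord0).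
by congr (t.1 _); apply: val_inj; rewrite /= modnn.
Qed.

Lemma inner_inj (t t' : config) :
  (forall j, (j < L.+1)%N -> inner t j = inner t' j) -> t = t'.
Proof.
move=> eq_inner; apply: injective_projections; apply/ffunP => i; have := ltn_ord i.
  by rewrite -!inner0 => i_lt; apply: eq_inner; lia.
move=> i_lt; apply: injective_projections.
  by rewrite -!inner1; apply: eq_inner; lia.
by rewrite -!inner2; apply: eq_inner; lia.
Qed.

Lemma walk_inner (E : rel V) (t : config) :
  (forall i : 'I_m, [/\ E (t.1 i) (t.2 i).1, E (t.2 i).1 (t.2 i).2
                      & E (t.2 i).2 (t.1 (ordS i))]) ->
  walk E (inner t) L.+1.
Proof.
move=> edges; apply/walkP => j j_lt; rewrite (divn_eq j 3) mulnC.
have i_lt : (j %/ 3 < m)%N by rewrite ltn_divLR //; lia.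
have [edge_sc edge_cd edge_ds] := edges (Ordinal i_lt).
rewrite -[(j %/ 3)%N]/(val (Ordinal i_lt)).
have := ltn_mod j 3; case: (j %% 3)%N => [|[|[|//]]] _.
- by rewrite addn0 inner0 inner1.
- by rewrite addn1 inner1 inner2.
- by rewrite addn2 inner2 inner3.
Qed.

End Configurations.

Section KeptEdges.
Variables (R : realFieldType) (V : finType) (B : rel V).
Variables (avoided : {set V * V * V * V * V * V}) (deg_min path_min pair_max : R).
Local Notation N := (#|V|%:R : R).

Definition neighbors (v : V) : {set V} := [set a | B v a].

Definition paths3 (a b : V) : {set V * V} :=
  [set p | [&& B a p.1, B p.1 p.2 & B p.2 b]].

Definition safe_paths (y x a b : V) : {set V * V} :=
  [set p in paths3 a b | (y, a, p.1, p.2, b, x) \notin avoided].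

Definition deficient (y x a b : V) : bool :=
  #|safe_paths y x a b|%:R < path_min * N ^+ 2.

Definition deficient_pairs (y x : V) : {set V * V} :=
  [set p | [&& p.1 \in neighbors y, p.2 \in neighbors x & deficient y x p.1 p.2]].

Definition kept (y x : V) : bool :=
  [&& B y x, deg_min * N <= #|neighbors y|%:R, deg_min * N <= #|neighbors x|%:R
    & #|deficient_pairs y x|%:R <= pair_max * N ^+ 2].

Hypothesis B_sym : symmetric B.
Hypothesis N_gt0 : 0 < N.
Hypothesis deg_min_ge0 : 0 <= deg_min.
Hypothesis path_min_gt0 : 0 < path_min.
Hypothesis pair_max_gt0 : 0 < pair_max.
Hypothesis card_avoided : #|avoided|%:R <= path_min ^+ 2 * N ^+ 6.

Definition path_through (p p' : V * V) : bool :=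
  [&& B p.1 p.2, p'.1 \in neighbors p.1 & p'.2 \in neighbors p.2].

Definition closing_hexagons (p p' : V * V) : {set V * V} :=
  [set q | (p.1, p'.1, q.1, q.2, p'.2, p.2) \in avoided].

Lemma card_path_through p' :
  #|[set p | path_through p p']| = #|paths3 p'.1 p'.2|.
Proof.
apply: eq_card => p; rewrite !inE /path_through !inE [B p.1 p'.1]B_sym.
by case: (B p.1 p.2); rewrite ?andbF.
Qed.

Lemma card_many_closing_hexagons :
  #|[set t | path_min * N ^+ 2 <= #|closing_hexagons t.1 t.2|%:R]|%:R
    <= path_min * N ^+ 4.
Proof.
have pathsN_gt0 : 0 < path_min * N ^+ 2 by rewrite mulr_gt0 ?exprn_gt0.
rewrite -(ler_pM2r pathsN_gt0); apply: le_trans (card_heavy_fibers _ _) _.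
have -> : path_min * N ^+ 4 * (path_min * N ^+ 2) = path_min ^+ 2 * N ^+ 6 by ring.
apply: le_trans card_avoided; rewrite ler_nat.
pose hex (t : V * V * (V * V) * (V * V)) :=
  (t.1.1.1, t.1.2.1, t.2.1, t.2.2, t.1.2.2, t.1.1.2).
have hex_inj : injective hex.
  by move=> [[[? ?] [? ?]] [? ?]] [[[? ?] [? ?]] [? ?]] [-> -> -> -> -> ->].
rewrite -(card_imset _ hex_inj); apply/subset_leq_card/subsetP => _ /imsetP[t + ->].
by rewrite inE.
Qed.

Lemma card_deficient :
  #|[set t : (V * V) * (V * V) |
      path_through t.1 t.2 && deficient t.1.1 t.1.2 t.2.1 t.2.2]|%:R
    <= 3 * path_min * N ^+ 4.
Proof.
set D := [set t | _].
pose few_paths := [set t : (V * V) * (V * V) | path_through t.1 t.2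
  && (#|[set p | path_through p t.2]|%:R < 2 * path_min * N ^+ 2)].
pose many_hexagons := [set t : (V * V) * (V * V) |
  path_min * N ^+ 2 <= #|closing_hexagons t.1 t.2|%:R].
have few : #|few_paths|%:R <= 2 * path_min * N ^+ 4.
  have -> : 2 * path_min * N ^+ 4 = #|{: V * V}|%:R * (2 * path_min * N ^+ 2).
    by rewrite card_prod natrM; ring.
  by apply: card_light_fibers; rewrite !mulr_ge0 ?exprn_ge0 // ltW.
have : (#|D| <= #|few_paths| + #|many_hexagons|)%N.
  apply: subset_leq_cardU; apply/subsetP => -[[y x] [a b]].
  rewrite !inE /= => /andP[-> few_safe] /=; rewrite card_path_through /=.
  case: ltP => //= many_paths.
  have : (#|paths3 a b| <= #|safe_paths y x a b| + #|closing_hexagons (y, x) (a, b)|)%N.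
    apply: subset_leq_cardU; apply/subsetP => p; rewrite !inE => -> /=.
    by case: (_ \in avoided).
  by rewrite -(ler_nat R) natrD; move: few_safe; rewrite /deficient; lra.
rewrite -(ler_nat R) natrD; have := card_many_closing_hexagons.
rewrite -/many_hexagons; lra.
Qed.

Lemma card_low_degree :
  #|[set p : V * V | B p.1 p.2 && (#|neighbors p.1|%:R < deg_min * N)]|%:R
    <= deg_min * N ^+ 2.
Proof.
pose low v a := B v a && (#|neighbors v|%:R < deg_min * N).
rewrite -(card_pairs_swap low) expr2 mulrA [leRHS]mulrC.
by apply: (@card_light_fibers _ _ _ (fun a v => B v a)); rewrite mulr_ge0.
Qed.

Lemma card_many_deficient_pairs :
  #|[set p : V * V | B p.1 p.2
      && (pair_max * N ^+ 2 < #|deficient_pairs p.1 p.2|%:R)]|%:R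
    <= 3 * path_min / pair_max * N ^+ 2.
Proof.
set many := [set p | _].
have pairsN_gt0 : 0 < pair_max * N ^+ 2 by rewrite mulr_gt0 ?exprn_gt0.
rewrite -(ler_pM2r pairsN_gt0).
have -> : 3 * path_min / pair_max * N ^+ 2 * (pair_max * N ^+ 2)
    = 3 * path_min * N ^+ 4.
  by field; rewrite gt_eqF.
apply: le_trans card_deficient.
apply: le_trans (card_heavy_fibers (fun p p' => path_through p p'
  && deficient p.1 p.2 p'.1 p'.2) (pair_max * N ^+ 2)).
rewrite ler_pM2r // ler_nat subset_leq_card //; apply/subsetP => p.
rewrite !inE => /andP[Bp /ltW/le_trans]; apply; rewrite ler_nat subset_leq_card //.
by apply/subsetP => p'; rewrite !inE /path_through Bp !inE andbA.
Qed.

Lemma card_not_kept :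
  #|[set p : V * V | B p.1 p.2 && ~~ kept p.1 p.2]|%:R
    <= (2 * deg_min + 3 * path_min / pair_max) * N ^+ 2.
Proof.
pose low v a := B v a && (#|neighbors v|%:R < deg_min * N).
pose low1 := [set p | low p.1 p.2].
pose low2 := [set p | low p.2 p.1].
pose many := [set p : V * V | B p.1 p.2
  && (pair_max * N ^+ 2 < #|deficient_pairs p.1 p.2|%:R)].
have : (#|[set p : V * V | B p.1 p.2 && ~~ kept p.1 p.2]|
    <= #|low1| + #|low2| + #|many|)%N.
  apply: (@leq_trans (#|low1 :|: low2| + #|many|)).
    apply: subset_leq_cardU; apply/subsetP => p; rewrite !inE => /andP[Bp].
    by rewrite /kept Bp /low [B p.2 p.1]B_sym Bp /= !negb_and -!ltNge orbA.
  by rewrite leq_add2r leq_card_setU.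
rewrite -(ler_nat R) !natrD [#|low2|]card_pairs_swap => /le_trans; apply.
have := card_low_degree; have := card_many_deficient_pairs; rewrite -/many -/low1.
lra.
Qed.

End KeptEdges.

Section Extensions.
Variables (R : realFieldType) (V : finType) (B : rel V).
Variables (avoided : {set V * V * V * V * V * V}) (deg_min path_min pair_max : R).
Local Notation N := (#|V|%:R : R).
Variables (M : nat) (v : nat -> V).
Local Notation m := M.+1.
Local Notation L := (3 * M).+2.

Definition link_hexagon (t : config V M) (i : 'I_m) : V * V * V * V * V * V :=
  (v i, t.1 i, (t.2 i).1, (t.2 i).2, t.1 (ordS i), v i.+1).

Definition spokes (i : 'I_m) : {set V} := neighbors B (v i).

Definition link_deficient (s : {ffun 'I_m -> V}) (i : 'I_m) : bool :=
  deficient B avoided path_min (v i) (v i.+1) (s i) (s (ordS i)).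

Definition good_spokes : {set {ffun 'I_m -> V}} :=
  [set s in family spokes | [forall i, ~~ link_deficient s i]].

Definition links (s : {ffun 'I_m -> V}) (i : 'I_m) : {set V * V} :=
  safe_paths B avoided (v i) (v i.+1) (s i) (s (ordS i)).

Definition extensions : {set config V M} :=
  [set t | (t.1 \in good_spokes) && (t.2 \in family (links t.1))].

Hypothesis v_closed : v m = v 0%N.

Lemma closed_walk_ordS (i : 'I_m) : v (ordS i) = v i.+1.
Proof.
rewrite /=; have := ltn_ord i; rewrite leq_eqVlt => /orP[/eqP->|i_lt].
  by rewrite modnn v_closed.
by rewrite modn_small.
Qed.

Section Members.
Variable t : config V M.
Hypothesis t_ext : t \in extensions.

Lemma extension_spoke (i : 'I_m) : B (v i) (t.1 i).
Proof.
move: t_ext; rewrite inE => /andP[+ _]; rewrite inE => /andP[/familyP/(_ i) + _].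
by rewrite !inE.
Qed.

Lemma extension_link (i : 'I_m) : (t.2 i \in paths3 B (t.1 i) (t.1 (ordS i)))
  /\ link_hexagon t i \notin avoided.
Proof.
by move: t_ext; rewrite inE => /andP[_ /familyP/(_ i)]; rewrite inE => /andP[].
Qed.

Lemma extension_walk : walk B (inner t) L.+1.
Proof.
by apply: walk_inner => i; have [+ _] := extension_link i; rewrite inE => /and3P[].
Qed.

End Members.

Hypothesis M_gt0 : (0 < M)%N.
Hypothesis N_gt0 : 0 < N.
Hypothesis deg_min_gt0 : 0 < deg_min.
Hypothesis path_min_ge0 : 0 <= path_min.
Hypothesis pair_max_le : 2 * m%:R * pair_max <= deg_min ^+ 2.
Hypothesis v_kept : walk (kept B avoided deg_min path_min pair_max) v m.

Lemma ordS_neq (i : 'I_m) : i != ordS i.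
Proof.
apply/eqP => /(congr1 val) /=; have := ltn_ord i.
rewrite leq_eqVlt => /orP[/eqP[iM]|i_lt].
  by rewrite iM modnn => M0; move: M_gt0; rewrite M0.
by rewrite modn_small //; lia.
Qed.

Lemma card_spokes (i : 'I_m) : deg_min * N <= #|spokes i|%:R.
Proof. by have /walkP/(_ i (ltn_ord i))/and4P[] := v_kept. Qed.

Lemma card_bad_spokes (i : 'I_m) :
  2 * m%:R * #|[set s in family spokes | link_deficient s i]|%:R
    <= #|family spokes|%:R :> R.
Proof.
set bad := [set s in family spokes | _].
have degN_gt0 : 0 < deg_min ^+ 2 * N ^+ 2 by rewrite mulr_gt0 ?exprn_gt0.
have /walkP/(_ i (ltn_ord i))/and4P[_ _ _ few_pairs] := v_kept.
have badE : bad = [set s in family spokes |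
    (s i, s (ordS i)) \in deficient_pairs B avoided path_min (v i) (v i.+1)].
  apply/setP => s; rewrite !in_set; apply: andb_id2l => /familyP s_spokes.
  have := s_spokes i; have := s_spokes (ordS i).
  by rewrite /spokes closed_walk_ordS !inE => -> ->.
have bad_le : #|bad|%:R * (deg_min ^+ 2 * N ^+ 2)
    <= pair_max * N ^+ 2 * #|family spokes|%:R.
  apply: le_trans (ler_wpM2r (ler0n _ _) few_pairs).
  rewrite -natrM badE; apply: le_trans (_ : _ <= (_ * (_ * _))%:R) _; last first.
    by rewrite ler_nat; apply: card_family_pair (ordS_neq i).
  rewrite !natrM ler_wpM2l // -exprMn expr2.
  by rewrite ler_pM ?card_spokes // mulr_ge0 // ltW.
rewrite -(ler_pM2r degN_gt0) -[leLHS]mulrA.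
apply: (@le_trans _ _ (2 * m%:R * (pair_max * N ^+ 2 * #|family spokes|%:R))).
  by rewrite ler_wpM2l ?mulr_ge0.
have -> : 2 * m%:R * (pair_max * N ^+ 2 * #|family spokes|%:R)
  = #|family spokes|%:R * (2 * m%:R * pair_max * N ^+ 2) by ring.
by rewrite ler_wpM2l // ler_wpM2r ?exprn_ge0.
Qed.

Lemma card_good_spokes : #|family spokes|%:R <= 2 * #|good_spokes|%:R :> R.
Proof.
pose bad i := [set s in family spokes | link_deficient s i].
have : (#|family spokes| <= #|good_spokes| + #|\bigcup_i bad i|)%N.
  rewrite -[#|family spokes|]cardsE; apply: subset_leq_cardU; apply/subsetP => s.
  rewrite in_set in_setU in_set => s_spokes; rewrite s_spokes.
  case: (boolP [forall i, _]) => //= /forallPn[i]; rewrite negbK => bad_i.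
  by apply/bigcupP; exists i; rewrite // in_set s_spokes.
move=> /leq_trans/(_ (leq_add (leqnn _) (leq_card_bigcup _ _))).
rewrite -(ler_nat R) natrD natr_sum.
have : \sum_i (2 * m%:R * #|bad i|%:R) <= \sum_(i < m) #|family spokes|%:R :> R.
  by apply: ler_sum => i _; apply: card_bad_spokes.
rewrite -mulr_sumr sumr_const card_ord -[leRHS]mulr_natl.
rewrite -[leLHS]mulrA mulrCA ler_pM2l //.
lra.
Qed.

Lemma card_extensions :
  (deg_min * N) ^+ m * (path_min * N ^+ 2) ^+ m <= 2 * #|extensions|%:R.
Proof.
have path_ge0 : 0 <= path_min * N ^+ 2 by rewrite mulr_ge0 ?exprn_ge0.
have spokes_ge : (deg_min * N) ^+ m <= #|family spokes|%:R.
  rewrite -[X in _ ^+ X]card_ord card_family_ge ?mulr_ge0 ?ltW // => i.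
  exact: card_spokes.
rewrite (card_pairs (fun s f => (s \in good_spokes) && (f \in family (links s)))).
apply: (@le_trans _ _ (2 * (#|good_spokes|%:R * (path_min * N ^+ 2) ^+ m))).
  rewrite mulrA ler_wpM2r ?exprn_ge0 //; exact: le_trans spokes_ge card_good_spokes.
rewrite ler_pM2l // natr_sum mulr_natl -sumr_const big_mkcond /=.
apply: ler_sum => s _; case: ifP => // s_good.
rewrite /= cardsE -[X in _ ^+ X]card_ord card_family_ge // => i.
by move: s_good; rewrite inE => /andP[_ /forallP/(_ i)]; rewrite -leNgt.
Qed.

End Extensions.

(** * Rich walks in a graph with pivots *)

(* For a pivot [q], [pivot_label q] is its label, [pivot_edge q] the set of edges
   that span a popular rectangle with it, and [spoke_label q v] the label of the
   edge from [v] to the opposite end of [q]. The relation [turn c z s t] stands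
   for the popularity of a rectangle on a pivot labelled [c] and an edge labelled
   [z] whose ends have spokes labelled [s] and [t]. *)
Record pivoted_graph (V Z Q : finType) := PivotedGraph {
  edge : rel V;
  label : V -> V -> Z;
  pivot_edge : Q -> rel V;
  pivot_label : Q -> Z;
  spoke_label : Q -> V -> Z;
  turn : Z -> Z -> rel Z;
  label_sym : forall v w, label v w = label w v;
  label_inj : forall v w w', edge v w -> edge v w' -> label v w = label v w' -> w = w';
  pivot_edge_sub : forall q, subrel (pivot_edge q) edge;
  pivot_edge_sym : forall q, symmetric (pivot_edge q);
  turn_pivot : forall q v w, pivot_edge q v w ->
    turn (pivot_label q) (label v w) (spoke_label q v) (spoke_label q w);
  pivot_inj : forall q q' v w w', pivot_edge q v w -> pivot_edge q' v w' ->
    pivot_label q = pivot_label q' -> spoke_label q v = spoke_label q' v -> q = q'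
}.

Section RichWalks.
Variables (R : realFieldType) (V Z Q : finType) (G : pivoted_graph V Z Q).

Definition turns_le (D : R) : Prop :=
  (forall c z s, #|[set t | turn G c z s t]|%:R <= D) /\
  (forall c s t, #|[set z | turn G c z s t]|%:R <= D).

Definition pivots (w : nat -> V) (n : nat) : {set Q} :=
  [set q | walk (pivot_edge G q) w n].

Definition rich (p : R) (n : nat) (w : nat -> V) : bool :=
  p * #|Z|%:R ^+ 2 <= #|pivots w n|%:R.

Definition poor (T : finType) (w : T -> nat -> V) (n : nat) (p : R) (q : Q) : {set T} :=
  [set t | (q \in pivots (w t) n) && ~~ rich p n (w t)].

Lemma sum_card_poor (T : finType) (w : T -> nat -> V) (n : nat) (p : R) : 0 <= p ->
  \sum_q #|poor w n p q|%:R <= #|T|%:R * (p * #|Z|%:R ^+ 2).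
Proof.
move=> p_ge0; rewrite -natr_sum; set c := p * _.
pose poor_at q t :=
  (q \in pivots (w t) n) && (#|[set q | q \in pivots (w t) n]|%:R < c).
have c_ge0 : 0 <= c by rewrite mulr_ge0 ?exprn_ge0.
apply: le_trans (card_light_fibers (fun q t => q \in pivots (w t) n) c_ge0).
rewrite ler_nat (card_pairs poor_at) leq_sum // => q _.
apply: subset_leq_card; apply/subsetP => t.
by rewrite !inE /poor_at /rich -ltNge cardsE inE.
Qed.

Variable D : R.
Hypothesis turns_D : turns_le D.

(* Guess the label of a pivot and of its first spoke, and go around the walk. *)
Lemma card_rich_completions (p : R) (n : nat) (l : nat -> Z) (W : {set Z}) :
  0 < p -> (0 < #|Z|)%N ->
  (forall z, z \in W -> exists2 w, rich p n.+1 w & completes (label G) l n z w) ->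
  #|W|%:R <= D ^+ n.+1 / p.
Proof.
move=> p_gt0 Z_gt0 completions; have [turn_end turn_label] := turns_D.
have sqrZ_gt0 : 0 < #|Z|%:R ^+ 2 :> R by rewrite exprn_gt0 // ltr0n.
rewrite ler_pdivlMr // -(ler_pM2r sqrZ_gt0) -mulrA [leRHS]mulrC.
have cardZZ : #|Z|%:R ^+ 2 = #|[set: Z * Z]|%:R :> R.
  by rewrite cardsT card_prod mulnn natrX.
rewrite [in leRHS]cardZZ.
pose step (c : Z * Z) (i : nat) := turn G c.1.
apply: (card_mul_le_codes (decodes := fun c => closes (step c) l n c.2)); last first.
  move=> c W'; apply: card_closing_labels => *; first exact: turn_end.
  exact: turn_label.
move=> z /completions[w rich_w [w_closed lab_w lab_z]].
pose code q := (pivot_label G q, spoke_label G q (w 0%N)).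
exists (code @: pivots w n.+1); split; first exact: subsetT.
  rewrite card_in_imset // => q q'; rewrite !inE => /walkP wq /walkP wq' [].
  exact: pivot_inj (wq 0%N isT) (wq' 0%N isT).
move=> _ /imsetP[q + ->]; rewrite inE => /walkP wq.
exists (fun i => spoke_label G q (w i)); split=> // [i i_n|].
  by rewrite -lab_w //; apply/turn_pivot/wq/ltnW.
by rewrite -lab_z /= -w_closed; apply/turn_pivot/wq.
Qed.

Section RichHexagons.
Variable hex_min : R.
Hypothesis hex_min_gt0 : 0 < hex_min.
Hypothesis Z_gt0 : (0 < #|Z|)%N.

Definition hexagon (h : V * V * V * V * V * V) : nat -> V :=
  let: (y, a, c, d, b, x) := h in nth y [:: y; a; c; d; b; x; y].

Definition hexagon_labels (h : V * V * V * V * V * V) : seq Z :=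
  [seq label G (hexagon h i) (hexagon h i.+1) | i <- iota 0 6].

Definition rich_labels (r : seq Z) : bool :=
  [exists h, rich hex_min 6 (hexagon h) && (hexagon_labels h == r)].

Lemma card_rich_labels_edge z1 z2 z3 z4 z5 :
  #|[set z | rich_labels [:: z1; z2; z3; z4; z5; z]]|%:R <= D ^+ 6 / hex_min.
Proof.
apply: (@card_rich_completions _ 5 (nth z1 [:: z1; z2; z3; z4; z5])) => // z.
rewrite inE => /existsP[[[[[[y a] c] d] b] x]] /andP[rich_h].
case/eqP=> lab1 lab2 lab3 lab4 lab5 lab6.
by exists (hexagon (y, a, c, d, b, x)) => //; split=> // -[|[|[|[|[|i]]]]].
Qed.

Lemma card_rich_labels_spoke z1 z2 z3 z4 z6 :
  #|[set z | rich_labels [:: z1; z2; z3; z4; z; z6]]|%:R <= D ^+ 6 / hex_min.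
Proof.
apply: (@card_rich_completions _ 5 (nth z6 [:: z6; z1; z2; z3; z4])) => // z.
rewrite inE => /existsP[[[[[[y a] c] d] b] x]] /andP[rich_h].
case/eqP=> lab1 lab2 lab3 lab4 lab5 lab6.
exists (hexagon (x, y, a, c, d, b)); last by split=> // -[|[|[|[|[|i]]]]].
apply: le_trans rich_h _; rewrite ler_nat subset_leq_card //; apply/subsetP => q.
by rewrite !inE /walk /=; case/and5P=> -> -> -> -> /and3P[-> -> _].
Qed.

Section InnerLabels.
Variables (M : nat) (walk_min : R).
Hypothesis walk_min_gt0 : 0 < walk_min.
Local Notation m := M.+1.
Local Notation L := (3 * M).+2.
Local Notation config := (config V M).
Local Notation labels := ({ffun 'I_L -> Z} * Z)%type.

Definition inner_labels (t : config) : labels :=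
  ([ffun i : 'I_L => label G (inner t i) (inner t i.+1)],
   label G (inner t L) (inner t L.+1)).

Definition nth_label (g : labels) (j : nat) : Z :=
  if insub j is Some i then g.1 i else g.2.

Lemma nth_inner_labels (t : config) (j : nat) : (j < L.+1)%N ->
  nth_label (inner_labels t) j = label G (inner t j) (inner t j.+1).
Proof.
rewrite ltnS leq_eqVlt => /orP[/eqP->|j_lt]; first by rewrite /nth_label insubN ?ltnn.
by rewrite /nth_label insubT /= ffunE.
Qed.

Definition rich_inner_labels : {set labels} :=
  [set g | [exists t, (inner_labels t == g) && rich walk_min L.+1 (inner t)]].

Lemma card_rich_inner_labels :
  #|rich_inner_labels|%:R <= #|Z|%:R ^+ L * (D ^+ L.+1 / walk_min).
Proof.
pose realized (h : {ffun 'I_L -> Z}) z :=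
  [exists t, (inner_labels t == (h, z)) && rich walk_min L.+1 (inner t)].
have -> : rich_inner_labels = [set g | realized g.1 g.2].
  by apply/setP => -[h z]; rewrite !inE.
rewrite card_pairs natr_sum.
have -> : #|Z|%:R ^+ L = #|{: {ffun 'I_L -> Z}}|%:R :> R.
  by rewrite card_ffun card_ord natrX.
rewrite mulr_natl -sumr_const; apply: ler_sum => h _.
apply: (@card_rich_completions _ L (nth_label (h, h ord0))) => // z.
rewrite inE => /existsP[t /andP[/eqP[h_t z_t] rich_t]].
exists (inner t) => //; split=> // [|i i_lt]; first exact: inner_closed.
by rewrite /nth_label insubT -h_t /= ffunE.
Qed.

Lemma walk_eq_of_labels (w w' : nat -> V) (n : nat) :
  walk (edge G) w n -> walk (edge G) w' n ->
  (forall j, (j < n)%N -> label G (w j) (w j.+1) = label G (w' j) (w' j.+1)) ->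
  w 0%N = w' 0%N -> forall j, (j <= n)%N -> w j = w' j.
Proof.
move=> /walkP Ew /walkP Ew' eq_label eq0; elim=> [//|j IHj] j_lt.
have eq_j := IHj (ltnW j_lt).
apply: (label_inj (Ew _ j_lt)); last by rewrite eq_label // -eq_j.
by rewrite eq_j; apply: Ew'.
Qed.

Lemma inner_labels_inj (y : V) (t t' : config) :
  edge G y (t.1 ord0) -> edge G y (t'.1 ord0) ->
  walk (edge G) (inner t) L.+1 -> walk (edge G) (inner t') L.+1 ->
  label G y (t.1 ord0) = label G y (t'.1 ord0) -> inner_labels t = inner_labels t' ->
  t = t'.
Proof.
move=> Et Et' walk_t walk_t' eq_spoke eq_labels; apply: inner_inj => j /ltnW.
apply: walk_eq_of_labels => // [i i_lt|].
  by rewrite -!nth_inner_labels ?eq_labels.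
rewrite -(muln0 3) !(inner0 _ (@ord0 M)).
exact: label_inj Et Et' eq_spoke.
Qed.

Definition rich_extension (v : nat -> V) (t : config) : Prop :=
  [/\ edge G (v 0%N) (t.1 ord0), walk (edge G) (inner t) L.+1,
      forall i, rich hex_min 6 (hexagon (link_hexagon v t i))
    & rich walk_min L.+1 (inner t)].

Definition link_step (g : labels) (i : nat) (z : Z) : rel Z := fun s t =>
  rich_labels [:: s; nth_label g (3 * i); nth_label g (3 * i).+1;
                  nth_label g (3 * i).+2; t; z].

Lemma rich_extension_step (v : nat -> V) (t : config) (i : 'I_m) :
  rich_extension v t ->
  link_step (inner_labels t) i (label G (v i) (v i.+1))
    (label G (v i) (t.1 i)) (label G (v i.+1) (t.1 (ordS i))).
Proof.
case=> _ _ /(_ i) rich_link _; apply/existsP; exists (link_hexagon v t i).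
have i_lt := ltn_ord i; rewrite rich_link !nth_inner_labels; try lia.
rewrite inner0 inner1 inner2 inner3 /= [label G (v i.+1) _]label_sym.
by rewrite [label G (v i) (v i.+1)]label_sym.
Qed.

Lemma rich_extension_closes (v : nat -> V) (t : config) (l : nat -> Z) (z : Z) :
  completes (label G) l M z v -> rich_extension v t ->
  closes (link_step (inner_labels t)) l M (label G (v 0%N) (t.1 ord0)) z.
Proof.
move=> [v_closed lab_v lab_z] rich_t.
have spoke0 : t.1 (inZp 0) = t.1 ord0 by congr (t.1 _); apply: val_inj; rewrite /= mod0n.
exists (fun i => label G (v i) (t.1 (inZp i))); split=> [|i i_M|]; first by rewrite spoke0.
  have := rich_extension_step (Ordinal (ltnW i_M : (i < m)%N)) rich_t.
  rewrite lab_v //; congr (link_step _ _ _ (label G _ (t.1 _)) (label G _ (t.1 _))).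
  - by apply: val_inj; rewrite /= modn_small // ltnW.
  - by apply: val_inj.
have := rich_extension_step ord_max rich_t.
rewrite lab_z v_closed; congr (link_step _ _ _ (label G _ (t.1 _)) (label G _ (t.1 _))).
  by apply: val_inj; rewrite /= modn_small.
by apply: val_inj; rewrite /= modnn.
Qed.

(* The labels of the inner walk and of the first spoke determine an extension.
   Given the former, go around the outer walk through the rich hexagons. *)
Lemma card_extended_completions (l : nat -> Z) (W : {set Z}) (c : R) :
  (forall z, z \in W -> exists v, completes (label G) l M z v /\
     exists2 E : {set config},
       c <= #|E|%:R & forall t, t \in E -> rich_extension v t) ->
  #|W|%:R * c <= #|Z|%:R ^+ L.+1 * (D ^+ L.+1 / walk_min) * (D ^+ 6 / hex_min) ^+ m.
Proof.
move=> extended; have D_ge0 : 0 <= D.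
  have /card_gt0P [z0 _] := Z_gt0.
  by have [/(_ z0 z0 z0)/(le_trans (ler0n _ _))] := turns_D.
have bound_ge0 : 0 <= (D ^+ 6 / hex_min) ^+ m.
  by rewrite exprn_ge0 // divr_ge0 ?exprn_ge0 // ltW.
pose codes := setX [set: Z] rich_inner_labels.
apply: (@le_trans _ _ (#|codes|%:R * (D ^+ 6 / hex_min) ^+ m)); last first.
  rewrite cardsX cardsT natrM ler_wpM2r // exprS -mulrA ler_wpM2l //.
  exact: card_rich_inner_labels.
pose decodes (g : Z * labels) := closes (link_step g.2) l M g.1.
apply: (card_mul_le_codes (decodes := decodes)); last first.
  move=> g W'; apply: card_closing_labels => *.
    exact: card_rich_labels_spoke.
  exact: card_rich_labels_edge.
move=> z /extended[v [v_completes [E card_E rich_E]]].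
pose code (t : config) := (label G (v 0%N) (t.1 ord0), inner_labels t).
exists (code @: E); split.
- apply/subsetP => _ /imsetP[t /rich_E[_ _ _ rich_t] ->]; rewrite !inE /=.
  by apply/existsP; exists t; rewrite eqxx.
- rewrite card_in_imset // => t t'.
  move=> /rich_E[Et walk_t _ _] /rich_E[Et' walk_t' _ _] eq_code.
  apply: inner_labels_inj Et Et' walk_t walk_t' _ _.
    exact: (congr1 fst eq_code).
  exact: (congr1 snd eq_code).
by move=> _ /imsetP[t /rich_E rich_t ->]; apply: rich_extension_closes.
Qed.

End InnerLabels.
End RichHexagons.
End RichWalks.

(** * Choice of the pivot *)

Lemma card_symmetric_core (V : finType) (B K : rel V) : symmetric B ->
  (#|[set p : V * V | B p.1 p.2]| <= #|[set p : V * V | K p.1 p.2 && K p.2 p.1]|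
     + 2 * #|[set p : V * V | B p.1 p.2 && ~~ K p.1 p.2]|)%N.
Proof.
move=> B_sym; pose lost v w := B v w && ~~ K v w.
rewrite mul2n -addnn -[X in (_ <= _ + (_ + X))%N](card_pairs_swap lost) addnA.
set core := [set p | K p.1 p.2 && _].
apply: (@leq_trans (#|core :|: [set p | lost p.1 p.2]| + #|[set p | lost p.2 p.1]|)).
  apply: subset_leq_cardU; apply/subsetP => -[v w]; rewrite !inE /lost /= => Bvw.
  by rewrite [B w v]B_sym Bvw; case: (K v w); case: (K w v).
by rewrite leq_add2r leq_card_setU.
Qed.

Section DenseCore.
Variables (R : realFieldType) (V Z Q : finType) (G : pivoted_graph V Z Q).
Variables (e : R) (M : nat).
Local Notation N := (#|V|%:R : R).
Local Notation m := M.+1.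
Local Notation L := (3 * M).+2.
Hypothesis e_gt0 : 0 < e.
Hypothesis e_small : 160 * e <= 1.
Hypothesis M_gt0 : (0 < M)%N.
Hypothesis Z_gt0 : (0 < #|Z|)%N.
Hypothesis card_ZV : (#|Z| <= #|V|)%N.
Hypothesis card_Q : #|Q| = (#|Z| ^ 2)%N.
Hypothesis turns_e : turns_le G (e ^- 2).
Hypothesis dense : e / 4 * N ^+ 2 * #|Q|%:R
  <= \sum_q #|[set p : V * V | pivot_edge G q p.1 p.2]|%:R.

(* These values lose a proportion [2 * deg_min + 3 * path_min / pair_max = 5 * e ^+ 2]
   of the pairs in the deletion. The factor [e ^+ 2] in [hex_min] and [walk_min]
   makes the poor walks rare, on average over the pivots. *)
Let deg_min := e ^+ 2.
Let pair_max := e ^+ (m + 4).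
Let path_min := e ^+ (m + 6).
Let ext_min := e * (deg_min * path_min) ^+ m.
Let hex_min := e ^+ 2 * path_min ^+ 2.
Let walk_min := e ^+ 2 * ext_min.

Let N_gt0 : 0 < N. Proof. by rewrite ltr0n (leq_trans Z_gt0). Qed.
Let e_ge0 : 0 <= e. Proof. exact: ltW. Qed.
Let path_min_gt0 : 0 < path_min. Proof. exact: exprn_gt0. Qed.
Let ext_min_gt0 : 0 < ext_min.
Proof. by rewrite mulr_gt0 ?exprn_gt0 // mulr_gt0 ?exprn_gt0. Qed.
Let hex_min_gt0 : 0 < hex_min. Proof. by rewrite mulr_gt0 ?exprn_gt0. Qed.
Let walk_min_gt0 : 0 < walk_min. Proof. by rewrite mulr_gt0 ?exprn_gt0. Qed.

Lemma pair_max_le : 2 * m%:R * pair_max <= deg_min ^+ 2.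
Proof.
rewrite /pair_max /deg_min exprD -exprM mulrA -[leRHS]mul1r ler_wpM2r ?exprn_ge0 //.
have m_le : m%:R <= 2 ^+ M :> R by rewrite -natrX ler_nat ltn_expl.
apply: (@le_trans _ _ (2 ^+ m * e ^+ m)).
  by rewrite ler_wpM2r ?exprn_ge0 // exprS ler_wpM2l.
have e_half : 2 * e <= 1 by move: e_gt0 e_small; lra.
by rewrite -exprMn exprn_ile1 ?mulr_ge0.
Qed.

Definition poor_hexagons : Q -> {set V * V * V * V * V * V} :=
  poor G (@hexagon V) 6 hex_min.

Definition poor_configs : Q -> {set config V M} :=
  poor G (@inner V M) L.+1 walk_min.

Lemma sum_card_poor_le (T : finType) (w : T -> nat -> V) (n : nat) (c : R) : 0 <= c ->
  \sum_q #|poor G w n (e ^+ 2 * c) q|%:R <= e / 4 / 4 * (c * #|T|%:R) * #|Q|%:R.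
Proof.
move=> c_ge0; have p_ge0 : 0 <= e ^+ 2 * c by rewrite mulr_ge0 ?exprn_ge0.
apply: le_trans (sum_card_poor G w n p_ge0) _.
rewrite card_Q natrX mulrA ler_wpM2r ?exprn_ge0 //.
rewrite [leLHS]mulrC -[leLHS]mulrA ler_wpM2r ?mulr_ge0 //.
by rewrite expr2; move: e_gt0 e_small; nra.
Qed.

Lemma exists_rich_pivot : exists q,
  [/\ e / 8 * N ^+ 2 <= #|[set p : V * V | pivot_edge G q p.1 p.2]|%:R,
      #|poor_hexagons q|%:R <= path_min ^+ 2 * N ^+ 6
    & #|poor_configs q|%:R <= ext_min * N ^+ L.+1].
Proof.
rewrite (_ : e / 8 = e / 4 / 2); last by field.
apply: exists_large_with_small_exceptions => // [||||q|||].
- by rewrite card_Q expn_gt0 Z_gt0.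
- by rewrite exprn_gt0.
- by rewrite mulr_gt0 ?exprn_gt0.
- by rewrite mulr_gt0 ?exprn_gt0.
- by rewrite -natrX ler_nat (leq_trans (max_card _)) // card_prod mulnn.
- by rewrite divr_ge0.
- have <- : #|{: V * V * V * V * V * V}|%:R = N ^+ 6 by rewrite !card_prod !natrM; ring.
  by apply: sum_card_poor_le; rewrite exprn_ge0 ?ltW.
- have <- : #|{: config V M}|%:R = N ^+ L.+1 by rewrite card_config natrX.
  by apply: sum_card_poor_le; rewrite ltW.
Qed.

Section FixedPivot.
Variable q : Q.
Local Notation B := (pivot_edge G q).
Hypothesis B_dense : e / 8 * N ^+ 2 <= #|[set p : V * V | B p.1 p.2]|%:R.
Hypothesis few_poor_hexagons : #|poor_hexagons q|%:R <= path_min ^+ 2 * N ^+ 6.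
Hypothesis few_poor_configs : #|poor_configs q|%:R <= ext_min * N ^+ L.+1.

Definition kept_edge : rel V := kept B (poor_hexagons q) deg_min path_min pair_max.

Definition core : rel V := fun v w => kept_edge v w && kept_edge w v.

Lemma kept_edge_sub : subrel kept_edge B.
Proof. by move=> v w /and4P[]. Qed.

Lemma core_dense : e / 16 * N ^+ 2 <= #|[set p : V * V | core p.1 p.2]|%:R.
Proof.
have not_kept : #|[set p : V * V | B p.1 p.2 && ~~ kept_edge p.1 p.2]|%:R
    <= 5 * e ^+ 2 * N ^+ 2.
  have -> : 5 * e ^+ 2 = 2 * deg_min + 3 * path_min / pair_max.
    rewrite /path_min -[(m + 6)%N]/(m + (4 + 2))%N addnA exprD mulrA mulrAC mulfK.
      by rewrite /deg_min; ring.
    by rewrite gt_eqF ?exprn_gt0.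
  by apply: card_not_kept; rewrite ?exprn_gt0 ?exprn_ge0 //; apply: pivot_edge_sym.
have := card_symmetric_core kept_edge (@pivot_edge_sym _ _ _ G q).
rewrite -(ler_nat R) natrD natrM.
have : e ^+ 2 * N ^+ 2 <= e / 160 * N ^+ 2.
  by rewrite ler_wpM2r ?exprn_ge0 // expr2; move: e_gt0 e_small; nra.
move: B_dense not_kept; rewrite -/core; lra.
Qed.

Section FixedWalk.
Variable v : nat -> V.
Hypothesis v_closed : v m = v 0%N.
Hypothesis v_core : walk core v m.

Let v_kept : walk kept_edge v m.
Proof. by apply: walk_sub v_core => ? ? /andP[]. Qed.

Definition pivot_extensions : {set config V M} :=
  extensions B (poor_hexagons q) path_min M v.

Definition rich_extensions : {set config V M} :=
  [set t in pivot_extensions | rich G walk_min L.+1 (inner t)].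

Lemma pivot_extension_rich_link (t : config V M) (i : 'I_m) :
  t \in pivot_extensions -> rich G hex_min 6 (hexagon (link_hexagon v t i)).
Proof.
move=> t_ext; have [] := extension_link t_ext i; rewrite inE => /and3P[B_sc B_cd B_ds].
apply: contraNT => not_rich; rewrite inE not_rich andbT inE /walk /= B_sc B_cd B_ds andbT.
have /walkP/(_ i (ltn_ord i))/kept_edge_sub B_vv := v_kept.
have := extension_spoke t_ext (ordS i); rewrite closed_walk_ordS // pivot_edge_sym => ->.
by rewrite (extension_spoke t_ext) pivot_edge_sym B_vv.
Qed.

Lemma card_rich_extensions : ext_min * N ^+ L.+1 <= #|rich_extensions|%:R.
Proof.
have ext_ge := card_extensions v_closed M_gt0 N_gt0 (exprn_gt0 2 e_gt0)
  (ltW path_min_gt0) pair_max_le v_kept.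
have few_poor : (#|pivot_extensions| <= #|rich_extensions| + #|poor_configs q|)%N.
  apply: subset_leq_cardU; apply/subsetP => t t_ext; rewrite in_setU in_set t_ext /=.
  case: (boolP (rich _ _ _ _)) => //= not_rich.
  by rewrite inE not_rich andbT inE (extension_walk t_ext).
have : (deg_min * N) ^+ m * (path_min * N ^+ 2) ^+ m
    = (deg_min * path_min) ^+ m * N ^+ L.+1.
  rewrite -exprMn (_ : deg_min * N * _ = deg_min * path_min * N ^+ 3); last by ring.
  by rewrite exprMn -[N ^+ 3 ^+ m]exprM mulnS add3n.
have : 4 * ext_min * N ^+ L.+1 <= (deg_min * path_min) ^+ m * N ^+ L.+1.
  rewrite ler_wpM2r ?exprn_ge0 // /ext_min mulrA.
  rewrite ler_piMl ?exprn_ge0 ?mulr_ge0 ?exprn_ge0 //.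
  by move: e_gt0 e_small; lra.
move: few_poor_configs few_poor; rewrite -(ler_nat R) natrD.
move=> poor_le few_poor ext_min_le eq_ext; rewrite eq_ext in ext_ge; lra.
Qed.

Lemma mem_rich_extensions (t : config V M) :
  t \in rich_extensions -> rich_extension G hex_min walk_min v t.
Proof.
rewrite inE => /andP[t_ext rich_t]; split=> // [||i].
- exact: (pivot_edge_sub (extension_spoke t_ext ord0)).
- exact: walk_sub (@pivot_edge_sub _ _ _ G q) (extension_walk t_ext).
exact: pivot_extension_rich_link.
Qed.

End FixedWalk.

Lemma completion_exponent :
  (e ^- 2) ^+ L.+1 / walk_min * ((e ^- 2) ^+ 6 / hex_min) ^+ m
    = e ^- (4 * m ^ 2 + 48 * m + 4) * ext_min.
Proof.
have -> : walk_min = e ^+ (m * (m + 8) + 3).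
  by rewrite /walk_min /ext_min -exprD -exprM -exprS -exprD; congr (_ ^+ _); clear; lia.
have -> : hex_min = e ^+ (2 * m + 14).
  by rewrite /hex_min -exprM -exprD; congr (_ ^+ _); clear; lia.
have ext_minE : ext_min = e ^+ (m * (m + 8) + 1).
  by rewrite /ext_min -exprD -exprM -exprS; congr (_ ^+ _); clear; lia.
apply: (canRL (divfK _)); rewrite ?ext_minE ?expf_neq0 ?gt_eqF //.
rewrite !exprVn -!exprM -!invfM -!exprD exprVn -exprM -!invfM -!exprD.
by congr (_ ^- _); clear; lia.
Qed.

Lemma core_completions_le :
  completions_le (label G) core M (e ^- (4 * m ^ 2 + 48 * m + 4)).
Proof.
move=> l W completions.
have NL_gt0 : 0 < ext_min * N ^+ L.+1 by rewrite mulr_gt0 ?exprn_gt0.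
rewrite -(ler_pM2r NL_gt0).
apply: (le_trans (card_extended_completions (M := M) (l := l) turns_e hex_min_gt0 Z_gt0
  walk_min_gt0 _)) => [z /completions[v v_core v_completes]|].
  exists v; split=> //; have [v_closed _ _] := v_completes.
  exists (rich_extensions v); first exact: card_rich_extensions.
  by move=> t; apply: mem_rich_extensions.
rewrite -mulrA completion_exponent [leRHS]mulrA [leLHS]mulrC ler_wpM2l //.
  by rewrite mulr_ge0 ?invr_ge0 ?exprn_ge0 ?ltW.
by rewrite lerXn2r ?nnegrE // ler_nat.
Qed.

End FixedPivot.

Lemma exists_dense_completions_le : exists B : rel V,
  [/\ symmetric B, subrel B (edge G),
      e / 16 * N ^+ 2 <= #|[set p : V * V | B p.1 p.2]|%:R
    & completions_le (label G) B M (e ^- (4 * m ^ 2 + 48 * m + 4))].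
Proof.
have [q [B_dense few_poor_hexagons few_poor_configs]] := exists_rich_pivot.
exists (core q); split.
- by move=> v w; rewrite /core andbC.
- by move=> v w /andP[/kept_edge_sub/pivot_edge_sub].
- exact: core_dense.
exact: core_completions_le.
Qed.

End DenseCore.

(** * The graph of a partial Latin square *)

Section BipartiteGraph.
Variables (X Y : finType).

Definition bip_rel (S : {set X * Y}) : rel (X + Y) := fun v w =>
  match v, w with
  | inl x, inr y => (x, y) \in S
  | inr y, inl x => (x, y) \in S
  | _, _ => false
  end.

Lemma bip_rel_sym S : symmetric (bip_rel S).
Proof. by case=> [x|y] [x'|y']. Qed.

Lemma bip_rel_cells (A : {set X * Y}) (B : rel (X + Y)) :
  symmetric B -> subrel B (bip_rel A) ->
  B =2 bip_rel [set c | B (inl c.1) (inr c.2)].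
Proof.
move=> B_sym BA [x|y] [x'|y'] /=; rewrite ?inE //.
- by apply/negP => /BA.
- by apply/negP => /BA.
Qed.

Lemma card_bip_rel S : #|[set p | bip_rel S p.1 p.2]| = (2 * #|S|)%N.
Proof.
pose right (c : X * Y) : (X + Y) * (X + Y) := (inl c.1, inr c.2).
pose left (c : X * Y) : (X + Y) * (X + Y) := (inr c.2, inl c.1).
have right_inj : injective right by move=> [? ?] [? ?] [-> ->].
have left_inj : injective left by move=> [? ?] [? ?] [-> ->].
rewrite mul2n -addnn -{1}(card_imset _ right_inj) -(card_imset _ left_inj) -cardsUI.
rewrite [_ :&: _](_ : _ = set0) ?cards0 ?addn0; last first.
  apply/setP => p; rewrite !inE; apply/negP => /andP[/imsetP[c _ ->]].
  by case/imsetP.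
apply: eq_card => -[v w]; rewrite !inE.
apply/idP/idP => [|/orP[]/imsetP[[x y] xyS [-> ->]]] //.
case: v w => [x|y] [x'|y'] //= xyS; apply/orP; [left|right]; apply/imsetP.
- by exists (x, y').
- by exists (x', y).
Qed.

End BipartiteGraph.

Section Rectangles.
Variables (X Y Z : finType) (A : {set X * Y}) (phi : X * Y -> Z).
Hypothesis latin : partial_latin_square A phi.

(* The tuple is (x, u, y, v): two columns, then two rows. *)
Definition rectangle (t : X * X * Y * Y) : bool :=
  let: (x, u, y, v) := t in
  [&& (x, y) \in A, (u, y) \in A, (x, v) \in A & (u, v) \in A].

Definition rectangle_labels (t : X * X * Y * Y) : Z * Z * Z * Z :=
  let: (x, u, y, v) := t in (phi (x, y), phi (u, y), phi (x, v), phi (u, v)).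

Definition agree_on_three (l l' : Z * Z * Z * Z) : bool :=
  let: (z, a, b, c) := l in let: (z', a', b', c') := l' in
  (2 < (z == z') + (a == a') + (b == b') + (c == c'))%N.

(* Three labels and the column x determine the rectangle: go around it from x. *)
Lemma rectangle_inj t t' : rectangle t -> rectangle t' -> t.1.1.1 = t'.1.1.1 ->
  agree_on_three (rectangle_labels t) (rectangle_labels t') -> t = t'.
Proof.
case: latin => column_inj row_inj.
case: t t' => [[[x u] y] v] [[[x' u'] y'] v'] /and4P[xy uy xv uv].
move=> /and4P[xy' uy' xv' uv'] /= eq_x; subst x'.
have y_of_x := row_inj _ _ _ xy xy'; have v_of_x := row_inj _ _ _ xv xv'.
have u_of_y : y = y' -> phi (u, y) = phi (u', y') -> u = u'.
  by move=> eq_y; subst y'; apply: column_inj.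
have u_of_v : v = v' -> phi (u, v) = phi (u', v') -> u = u'.
  by move=> eq_v; subst v'; apply: column_inj.
have y_of_u : u = u' -> phi (u, y) = phi (u', y') -> y = y'.
  by move=> eq_u; subst u'; apply: row_inj.
have v_of_u : u = u' -> phi (u, v) = phi (u', v') -> v = v'.
  by move=> eq_u; subst u'; apply: row_inj.
case: eqP => [/y_of_x eq_y|_]; case: eqP => [eq_a|_]; case: eqP => [/v_of_x eq_v|_];
  case: eqP => [eq_c|_] //= _.
- by rewrite -(u_of_y eq_y eq_a) -eq_y -eq_v.
- by rewrite -(u_of_y eq_y eq_a) -eq_y -eq_v.
- have eq_u := u_of_y eq_y eq_a.
  by rewrite -(v_of_u eq_u eq_c) -eq_y -eq_u.
- by rewrite -(u_of_v eq_v eq_c) -eq_y -eq_v.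
have eq_u := u_of_v eq_v eq_c.
by rewrite -(y_of_u eq_u eq_a) -eq_v -eq_u.
Qed.

Lemma card_agreeing_rectangles (S : {set X * X * Y * Y}) :
  {in S, forall t, rectangle t} ->
  {in S &, forall t t', agree_on_three (rectangle_labels t) (rectangle_labels t')} ->
  (#|S| <= #|X|)%N.
Proof.
move=> rectS agreeS; apply: (@leq_card_in _ _ (fun t => t.1.1.1)) => t t' tS t'S eq_x.
by apply: rectangle_inj eq_x _; rewrite ?rectS ?agreeS.
Qed.

Definition rectangles_with (l : Z * Z * Z * Z) : {set X * X * Y * Y} :=
  [set t | rectangle t && (rectangle_labels t == l)].

Lemma card_rectangles_with l : (#|rectangles_with l| <= #|X|)%N.
Proof.
apply: card_agreeing_rectangles => [t|t t']; first by rewrite inE => /andP[].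
rewrite !inE => /andP[_ /eqP->] /andP[_ /eqP->].
by case: l => [[[z a] b] c] /=; rewrite !eqxx.
Qed.

Variables (R : realFieldType) (p : R).
Hypothesis p_ge0 : 0 <= p.

Definition popular (l : Z * Z * Z * Z) : bool := p <= #|rectangles_with l|%:R.

Definition popular_rectangle (t : X * X * Y * Y) : bool :=
  rectangle t && popular (rectangle_labels t).

Lemma card_popular_labels (f : Z -> Z * Z * Z * Z) :
  injective f -> (forall z z', agree_on_three (f z) (f z')) ->
  #|[set z | popular (f z)]|%:R * p <= #|X|%:R.
Proof.
move=> f_inj f_agree; pose P z t := t \in rectangles_with (f z).
have -> : [set z | popular (f z)] = [set z | p <= #|[set t | P z t]|%:R].
  by apply/setP => z; rewrite !inE /popular /P cardsE.
apply: le_trans (card_heavy_fibers _ _) _; rewrite ler_nat.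
have snd_inj : {in [set q | P q.1 q.2] &, injective snd}.
  move=> [z t] [z' t']; rewrite !inE /P !inE /= => /andP[_ /eqP lab_t].
  move=> /andP[_ /eqP lab_t'] eq_t; rewrite -eq_t lab_t in lab_t' *.
  by rewrite (f_inj _ _ lab_t').
rewrite -(card_in_imset snd_inj); apply: card_agreeing_rectangles => [t|t t'].
  by case/imsetP => q; rewrite inE /P inE => /andP[rect_q _] ->.
case/imsetP => q + ->; rewrite inE /P inE => /andP[_ /eqP->].
by case/imsetP => q' + ->; rewrite inE /P inE => /andP[_ /eqP->].
Qed.

Definition matching (t t' : X * X * Y * Y) : bool :=
  [&& rectangle t, rectangle t' & rectangle_labels t == rectangle_labels t'].

Lemma card_octahedra :
  (#|octahedra A phi| <= #|[set q | matching q.1 q.2]|)%N.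
Proof.
pose halves (t : X * X * Y * Y * X * X * Y * Y) :=
  let: (x1, x2, y1, y2, x3, x4, y3, y4) := t in ((x1, x2, y1, y2), (x3, x4, y3, y4)).
have halves_inj : injective halves.
  move=> [[[[[[[? ?] ?] ?] ?] ?] ?] ?] [[[[[[[? ?] ?] ?] ?] ?] ?] ?].
  by move=> [-> -> -> -> -> -> -> ->].
rewrite -(card_imset _ halves_inj); apply/subset_leq_card/subsetP => _ /imsetP[t + ->].
case: t => [[[[[[[x1 x2] y1] y2] x3] x4] y3] y4].
rewrite !inE /matching /= => /and5P[-> -> -> -> /and5P[-> -> -> ->]].
by move=> /and4P[/eqP-> /eqP-> /eqP-> /eqP->]; rewrite eqxx.
Qed.

Lemma card_popular_rectangles :
  #|octahedra A phi|%:R <= #|[set t | popular_rectangle t]|%:R * #|X|%:R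
    + (#|X| ^ 2 * #|Y| ^ 2)%:R * p.
Proof.
pose many := [set q | matching q.1 q.2 && popular_rectangle q.2].
pose few := [set q | matching q.1 q.2 && (#|[set t | matching t q.2]|%:R < p)].
have fiberE t' : rectangle t' ->
    [set t | matching t t'] = rectangles_with (rectangle_labels t').
  by move=> rect_t'; apply/setP => t; rewrite !inE /matching rect_t'.
have split_octahedra : (#|octahedra A phi| <= #|many| + #|few|)%N.
  apply: leq_trans card_octahedra _; apply: subset_leq_cardU; apply/subsetP => -[t t'].
  rewrite !inE /= => match_tt'; have /and3P[_ rect_t' _] := match_tt'.
  by rewrite match_tt' /popular_rectangle /popular rect_t' fiberE //=; case: ltP.
have card_many : #|many|%:R <= #|[set t | popular_rectangle t]|%:R * #|X|%:R :> R.
  rewrite -natrM ler_nat.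
  rewrite (card_pairsC (fun t t' => matching t t' && popular_rectangle t')).
  rewrite -sum_nat_const [leqRHS]big_mkcond; apply: leq_sum => t' _; rewrite inE.
  case: (boolP (popular_rectangle t')) => [/andP[rect_t' _]|_].
    under eq_finset do rewrite andbT.
    by rewrite fiberE // card_rectangles_with.
  by rewrite (_ : [set _ | _] = set0) ?cards0 //; apply/setP => t; rewrite !inE andbF.
have card_few : #|few|%:R <= (#|X| ^ 2 * #|Y| ^ 2)%:R * p.
  have -> : (#|X| ^ 2 * #|Y| ^ 2)%N = #|{: X * X * Y * Y}|.
    by rewrite !card_prod -!mulnn !mulnA.
  exact: card_light_fibers.
by move: split_octahedra; rewrite -(ler_nat R) natrD; lra.
Qed.

End Rectangles.

Section LatinSquareGraph.
Variables (R : realFieldType) (X Y Z : finType) (A : {set X * Y}) (phi : X * Y -> Z).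
Variables (e : R) (n : nat) (z0 : Z).
Hypothesis latin : partial_latin_square A phi.

(* [z0] is a junk value, on pairs that are not joined by a cell. *)
Definition cell_label (v w : X + Y) : Z :=
  match v, w with
  | inl x, inr y => phi (x, y)
  | inr y, inl x => phi (x, y)
  | _, _ => z0
  end.

Lemma cell_label_sym v w : cell_label v w = cell_label w v.
Proof. by case: v w => [x|y] [x'|y']. Qed.

Lemma cell_label_inj v w w' : bip_rel A v w -> bip_rel A v w' ->
  cell_label v w = cell_label v w' -> w = w'.
Proof.
case: latin => column_inj row_inj.
case: v w w' => [x|y] [x'|y'] [x''|y''] //= Avw Avw' eq_label; congr (_ _).
  exact: row_inj Avw Avw' eq_label.
exact: column_inj Avw Avw' eq_label.
Qed.

Let popular_label := popular A phi (e / 2 * n%:R).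

Definition pivot_cells (q : X * Y) : {set X * Y} :=
  [set c | popular_rectangle A phi (e / 2 * n%:R) (c.1, q.1, c.2, q.2)].

Definition spoke_cell_label (q : X * Y) (v : X + Y) : Z :=
  match v with inl x => phi (x, q.2) | inr y => phi (q.1, y) end.

(* Either orientation of the edge is allowed, which only doubles the bounds. *)
Definition popular_turn (c z s t : Z) : bool :=
  popular_label (z, t, s, c) || popular_label (z, s, t, c).

Lemma pivot_cellsP q c : c \in pivot_cells q ->
  [/\ c \in A, (q.1, c.2) \in A, (c.1, q.2) \in A & q \in A].
Proof. by rewrite inE => /andP[/and4P[]]; case: q c => [? ?] [? ?]. Qed.

Lemma pivot_cells_sub q : subrel (bip_rel (pivot_cells q)) (bip_rel A).
Proof. by case=> [x|y] [x'|y'] //= /pivot_cellsP[]. Qed.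

Lemma popular_turn_pivot q v w : bip_rel (pivot_cells q) v w ->
  popular_turn (phi q) (cell_label v w) (spoke_cell_label q v) (spoke_cell_label q w).
Proof.
case: q v w => [u v] [x|y] [x'|y'] //=.
all: rewrite inE /popular_turn => /andP[_ /= popular_xy].
  by rewrite /popular_label popular_xy.
by rewrite /popular_label popular_xy orbT.
Qed.

Lemma pivot_cells_inj q q' v w w' :
  bip_rel (pivot_cells q) v w -> bip_rel (pivot_cells q') v w' -> phi q = phi q' ->
  spoke_cell_label q v = spoke_cell_label q' v -> q = q'.
Proof.
case: latin => column_inj row_inj.
case: q q' v w w' => [u v] [u' v'] [x|y] [x'|y'] [x''|y''] //=.
  move=> /pivot_cellsP[_ _ /= xv uv] /pivot_cellsP[_ _ /= xv' uv'] eq_q eq_spoke.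
  have eq_v := row_inj _ _ _ xv xv' eq_spoke; subst v'.
  by rewrite (column_inj _ _ _ uv uv' eq_q).
move=> /pivot_cellsP[_ /= uy _ uv] /pivot_cellsP[_ /= uy' _ uv'] eq_q eq_spoke.
have eq_u := column_inj _ _ _ uy uy' eq_spoke; subst u'.
by rewrite (row_inj _ _ _ uv uv' eq_q).
Qed.

Definition latin_graph : pivoted_graph (X + Y)%type Z (X * Y)%type :=
  PivotedGraph cell_label_sym cell_label_inj pivot_cells_sub
    (fun q => @bip_rel_sym _ _ (pivot_cells q)) popular_turn_pivot pivot_cells_inj.

Hypothesis e_gt0 : 0 < e.
Hypothesis e_small : 160 * e <= 1.
Hypothesis n_gt0 : (0 < n)%N.
Hypothesis cardX : #|X| = n.

Lemma latin_turns_le : turns_le latin_graph (e ^- 2).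
Proof.
have p_gt0 : 0 < e / 2 * n%:R by rewrite mulr_gt0 ?divr_gt0 ?ltr0n.
have few (f : Z -> Z * Z * Z * Z) :
    injective f -> (forall z z', agree_on_three (f z) (f z')) ->
    #|[set z | popular_label (f z)]|%:R <= 2 / e.
  move=> f_inj f_agree; rewrite -(ler_pM2r p_gt0).
  have -> : 2 / e * (e / 2 * n%:R) = #|X|%:R by rewrite cardX; field; rewrite gt_eqF.
  exact: card_popular_labels.
have few_either (f g : Z -> Z * Z * Z * Z) : injective f -> injective g ->
    (forall z z', agree_on_three (f z) (f z')) ->
    (forall z z', agree_on_three (g z) (g z')) ->
    #|[set z | popular_label (f z) || popular_label (g z)]|%:R <= e ^- 2.
  move=> f_inj g_inj f_agree g_agree.
  have : 2 / e + 2 / e <= e ^- 2.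
    rewrite -[e ^- 2]mul1r ler_pdivlMr ?exprn_gt0 //.
    have -> : (2 / e + 2 / e) * e ^+ 2 = 4 * e by field; rewrite gt_eqF.
    by move: e_gt0 e_small; lra.
  apply: le_trans; apply: le_trans (lerD (few _ f_inj f_agree) (few _ g_inj g_agree)).
  by rewrite -natrD ler_nat subset_leq_cardU //; apply/subsetP => z; rewrite !inE.
split=> [c z s|c s t]; apply: few_either => [? ?|? ?|? ?|? ?]; try by case.
all: by rewrite /= !eqxx ?addnA //; case: eqP.
Qed.

Hypothesis cardY : #|Y| = n.
Hypothesis cardZ : #|Z| = n.
Hypothesis many_octahedra : e * n%:R ^+ 5 <= #|octahedra A phi|%:R.

Lemma pivot_cells_dense :
  e / 4 * #|{: X + Y}|%:R ^+ 2 * #|{: X * Y}|%:R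
    <= \sum_q #|[set p | bip_rel (pivot_cells q) p.1 p.2]|%:R.
Proof.
pose popular_cell (q c : X * Y) := c \in pivot_cells q.
have sum_pivots : (\sum_q #|pivot_cells q|
    = #|[set t | popular_rectangle A phi (e / 2 * n%:R) t]|)%N.
  under eq_bigr do rewrite -cardsE; rewrite -(card_pairs popular_cell).
  pose rect (p : (X * Y) * (X * Y)) := (p.2.1, p.1.1, p.2.2, p.1.2).
  have rect_inj : injective rect by move=> [[? ?] [? ?]] [[? ?] [? ?]] [-> -> -> ->].
  rewrite -(card_imset _ rect_inj); apply: eq_card => -[[[x u] y] v]; rewrite inE.
  apply/imsetP/idP => [[[[u' v'] [x' y']]]|popular_t].
    by rewrite inE /popular_cell inE /= => popular_t [-> -> -> ->].
  by exists ((u, v), (x, y)) => //; rewrite inE /popular_cell inE.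
under eq_bigr do rewrite card_bip_rel natrM.
rewrite -mulr_sumr -natr_sum sum_pivots card_prod card_sum cardX cardY.
have n_gt0r : 0 < n%:R :> R by rewrite ltr0n.
have p_ge0 : 0 <= e / 2 * n%:R by rewrite mulr_ge0 // divr_ge0 // ltW.
have := le_trans many_octahedra (card_popular_rectangles latin p_ge0).
rewrite cardX cardY !natrM natrD => few_unpopular.
rewrite -(ler_pM2r n_gt0r); move: few_unpopular.
lra.
Qed.

Lemma latin_square_completions_le (k : nat) : (2 <= k)%N ->
  exists B : {set X * Y}, [/\ B \subset A, e / 8 * n%:R ^+ 2 <= #|B|%:R
    & completions_le cell_label (bip_rel B) (2 * k).-1 (e ^- (33 * k ^ 3))].
Proof.
move=> k_ge2; have k_pred : (2 * k).-1.+1 = (2 * k)%N by move: k_ge2; clear; lia.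
have [||||B [B_sym BA B_dense B_completions]] := exists_dense_completions_le
  (M := (2 * k).-1) e_gt0 e_small _ _ _ _ latin_turns_le pivot_cells_dense.
- by move: k_ge2; clear; lia.
- by rewrite cardZ.
- by rewrite card_sum cardX cardZ leq_addr.
- by rewrite card_prod cardX cardY cardZ mulnn.
have BE := bip_rel_cells B_sym BA.
exists [set c | B (inl c.1) (inr c.2)]; split.
- by apply/subsetP => -[x y]; rewrite inE => /BA.
- move: B_dense; under eq_finset do rewrite BE.
  rewrite card_bip_rel card_sum cardX cardY natrM natrD; lra.
apply: completions_le_sub => [v v'|l W completions]; first by rewrite -BE; apply.
apply: le_trans (B_completions l W completions) _.
rewrite lef_pV2 ?posrE ?exprn_gt0 // ler_wiXn2l ?ltW //.
  by move: e_gt0 e_small; lra.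
by rewrite k_pred; move: k_ge2; clear; nia.
Qed.

End LatinSquareGraph.

(** * From cycles to closed walks *)

Section CycleWalks.
Variables (X Y : finType) (B : {set X * Y}) (r : nat) (p : (2 * r).-tuple (X * Y)).
Variable c0 : X * Y.
Hypothesis cycle_p : is_cycle B p.

Definition cycle_cell (j : nat) : X * Y := nth c0 p (j %% (2 * r)).

Definition cycle_walk (j : nat) : X + Y :=
  if odd j then inr (cycle_cell j).2 else inl (cycle_cell j).1.

Lemma cycle_walk_closed : cycle_walk (2 * r) = cycle_walk 0.
Proof. by rewrite /cycle_walk /cycle_cell modnn mod0n oddM. Qed.

Lemma cycle_cellP j : (j < 2 * r)%N -> cycle_cell j \in B /\
  (if odd j then (cycle_cell j).1 == (cycle_cell j.+1).1
   else (cycle_cell j).2 == (cycle_cell j.+1).2).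
Proof.
move=> j_lt; have /forallP/(_ (Ordinal j_lt))/andP[] := cycle_p.
by rewrite !(tnth_nth c0) /cycle_cell /= (modn_small j_lt).
Qed.

Lemma cycle_walk_edge j : (j < 2 * r)%N ->
  bip_rel B (cycle_walk j) (cycle_walk j.+1) /\
  forall (Z : finType) (phi : X * Y -> Z) z0,
    cell_label phi z0 (cycle_walk j) (cycle_walk j.+1) = phi (nth c0 p j).
Proof.
move=> j_lt; have [cellB] := cycle_cellP j_lt.
have -> : nth c0 p j = cycle_cell j by rewrite /cycle_cell modn_small.
rewrite /cycle_walk /=.
by case: (odd j) => /eqP <- /=; move: cellB; case: (cycle_cell j) => x y; split.
Qed.

End CycleWalks.

Lemma completion_well_defined_walk (R : realType) (X Y Z : finType) (phi : X * Y -> Z)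
    (B : {set X * Y}) (z0 : Z) (r : nat) (C : R) :
  (0 < r)%N -> completions_le (cell_label phi z0) (bip_rel B) (2 * r).-1 C ->
  completion_well_defined phi B r C.
Proof.
move=> r_gt0 B_completions z; apply: (B_completions (nth z0 z)) => w.
rewrite inE => /existsP[p /andP[cycle_p /eqP labels_p]].
have r2_gt0 : (0 < 2 * r)%N by rewrite muln_gt0.
have r2_pred : (2 * r).-1.+1 = (2 * r)%N by rewrite prednK.
pose c0 := tnth p (Ordinal r2_gt0).
have edge := cycle_walk_edge c0 cycle_p.
have label_p j : (j < 2 * r)%N -> phi (nth c0 p j) = nth z0 (rcons z w) j.
  by move=> j_lt; rewrite -labels_p (nth_map c0) ?size_tuple.
exists (cycle_walk p c0); rewrite ?r2_pred.
  by apply/walkP => j /edge[].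
split; rewrite ?r2_pred; first exact: cycle_walk_closed.
- move=> j j_lt; have j_lt2 : (j < 2 * r)%N by rewrite (leq_trans j_lt) ?leq_pred.
  by have [_ ->] := edge j j_lt2; rewrite label_p // nth_rcons size_tuple j_lt.
have last_lt : ((2 * r).-1 < 2 * r)%N by rewrite r2_pred.
have [_] := edge _ last_lt; rewrite r2_pred => ->.
by rewrite label_p // nth_rcons size_tuple ltnn eqxx.
Qed.

Lemma completion_well_defined_le (R : realType) (X Y Z : finType) (phi : X * Y -> Z)
    (B : {set X * Y}) (z0 : Z) (r k : nat) (C : R) :
  (0 < r <= k)%N -> completions_le (cell_label phi z0) (bip_rel B) (2 * k).-1 C ->
  completion_well_defined phi B r C.
Proof.
move=> /andP[r_gt0 r_le] B_completions.
apply: (completion_well_defined_walk (z0 := z0)) => //.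
apply: (completions_le_pad (j := k - r)) => //; first exact: bip_rel_sym.
- exact: cell_label_sym.
- by lia.
by rewrite (_ : (2 * r).-1 + 2 * (k - r) = (2 * k).-1)%N //; lia.
Qed.

Theorem theorem2p2 (R : realType) (eps : R) (k n : nat) (X Y Z : finType)
    (A : {set X * Y}) (phi : X * Y -> Z)
    (eps_gt0 : 0 < eps) (eps_lt : eps < 10 ^- 3) (k_ge2 : (2 <= k)%N)
    (cardX : #|X| = n) (cardY : #|Y| = n) (cardZ : #|Z| = n)
    (hA : partial_latin_square A phi)
    (hoct : eps * n%:R ^+ 5 <= #|octahedra A phi|%:R) :
  exists (B : {set X * Y}) (beta : R),
    [/\ B \subset A,
        #|B|%:R = beta * n%:R ^+ 2,
        eps ^+ 10 <= beta
      & forall r : nat, (2 <= r <= k)%N ->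
          completion_well_defined phi B r (eps ^- (33 * k ^ 3))].
Proof.
have eps_small : 160 * eps <= 1.
  by have : 10 ^- 3 = 1 / 1000 :> R by [field]; move: eps_lt; lra.
have C_ge0 : 0 <= eps ^- (33 * k ^ 3) by rewrite invr_ge0 exprn_ge0 ?ltW.
have [n0|n_gt0] := posnP n.
  exists set0, (eps ^+ 10); split=> [|||r _ z]; rewrite ?sub0set //.
    by rewrite cards0 n0 expr0n mulr0.
  by apply: le_trans C_ge0; rewrite -[0]/(0%:R) ler_nat -n0 -cardZ max_card.
have /card_gt0P[z0 _] : (0 < #|Z|)%N by rewrite cardZ.
have [B [BA B_dense B_completions]] := latin_square_completions_le z0 hA eps_gt0
  eps_small n_gt0 cardX cardY cardZ hoct k_ge2.
have sqr_n_gt0 : 0 < n%:R ^+ 2 :> R by rewrite exprn_gt0 // ltr0n.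
exists B, (#|B|%:R / n%:R ^+ 2); split=> // [||r /andP[r_ge2 r_le]].
- by rewrite divfK // gt_eqF.
- rewrite ler_pdivlMr //; apply: le_trans B_dense; rewrite ler_wpM2r ?exprn_ge0 //.
  apply: (@le_trans _ _ (eps ^+ 2)); last by rewrite expr2; nra.
  by rewrite ler_wiXn2l ?ltW //; lra.
- by apply: completion_well_defined_le B_completions; rewrite (ltnW r_ge2).
Qed.
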